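(* For the 2-server problem on the metric consisting of three equidistant collinear points, for a suitable initial configuration of the servers, every deterministic online algorithm has strict bijective ratio at least $2$ against the optimal offline algorithm.
   Context: Metric: three points $1,2,3$ on a line with distance $d>0$ between consecutive points. Two servers occupy points; each request is a point, to which an algorithm must move a server; cost is the total distance moved. The online algorithm and the optimal offline algorithm $\textsc{opt}$ start from the same initial configuration. $\mathcal{I}_n$ is the set of all request sequences of length $n$. The strict bijective ratio of an online algorithm $A$ against $B$ is at most $\rho$ if there is $n_0$ such that for all $n\ge n_0$ there exists a bijection $\pi:\mathcal{I}_n\to\mathcal{I}_n$ with $A(\sigma)\le\rho\cdot B(\pi(\sigma))$ for all $\sigma\in\mathcal{I}_n$; the ratio is the infimum of such $\rho$. *)

(* Defs.v *)
From HB Require Import structures.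
From mathcomp Require Import all_boot all_order all_algebra.
From mathcomp Require Import all_classical all_reals all_analysis.

Set Implicit Arguments.
Unset Strict Implicit.
Unset Printing Implicit Defensive.

Import Order.TTheory GRing.Theory Num.Theory.
Local Open Scope classical_set_scope.
Local Open Scope ring_scope.

(* Servers are labelled by 'I_k and may share a point. *)
Notation config T k := {ffun 'I_k -> T}.

Definition serves (T : finType) (k : nat) (c : config T k) (r : T) : bool :=
  [exists i : 'I_k, c i == r].

Definition move_cost (R : realType) (T : finType) (dist : T -> T -> R)
    (k : nat) (c c' : config T k) : R :=
  \sum_(i < k) dist (c i) (c' i).

(* A schedule lists the configurations reached after each successive request;
   [c] is the configuration before the first request. *)
Fixpoint schedule_cost (R : realType) (T : finType) (dist : T -> T -> R)
    (k : nat) (c : config T k) (s : seq (config T k)) : R :=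
  if s is c' :: s' then move_cost dist c c' + schedule_cost dist c' s' else 0.

(* [all2] also requires the two sequences to have the same length. *)
Definition feasible (T : finType) (k : nat)
    (s : seq (config T k)) (sigma : seq T) : bool :=
  all2 (@serves T k) s sigma.

(* A deterministic online algorithm: its configuration is a function of the
   requests revealed so far. *)
Record online_alg (T : finType) (k : nat) (c0 : config T k) := OnlineAlg {
  alg_config :> seq T -> config T k;
  alg_init : alg_config [::] = c0;
  alg_serves : forall (h : seq T) (r : T), serves (alg_config (rcons h r)) r
}.

Definition online_schedule (T : finType) (k : nat) (c0 : config T k)
    (A : online_alg c0) (sigma : seq T) : seq (config T k) :=
  [seq A (take t.+1 sigma) | t <- iota 0 (size sigma)].

Definition online_cost (R : realType) (T : finType) (dist : T -> T -> R)
    (k : nat) (c0 : config T k) (A : online_alg c0) (sigma : seq T) : R :=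
  schedule_cost dist c0 (online_schedule A sigma).

(* For k > 0 the infimum is over a finite nonempty set, hence a minimum. *)
Definition opt_cost (R : realType) (T : finType) (dist : T -> T -> R)
    (k : nat) (c0 : config T k) (sigma : seq T) : R :=
  inf [set schedule_cost dist c0 s | s in [set s | feasible s sigma]].

Definition strict_bijective_bound (R : realType) (T : finType)
    (costA costB : seq T -> R) (rho : R) : Prop :=
  exists n0 : nat, forall n : nat, (n0 <= n)%N ->
    exists pi : n.-tuple T -> n.-tuple T,
      bijective pi /\
      forall sigma : n.-tuple T, costA sigma <= rho * costB (pi sigma).

(* Extended-real valued, so that the ratio is +oo when no rho is a bound. *)
Definition strict_bijective_ratio (R : realType) (T : finType)
    (costA costB : seq T -> R) : \bar R :=
  ereal_inf [set rho%:E | rho in strict_bijective_bound costA costB].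

(* The points 1, 2, 3 are the elements 0, 1, 2 of 'I_3. *)
Definition line3_dist (R : realType) (d : R) (x y : 'I_3) : R :=
  d * `|(x : nat)%:R - (y : nat)%:R : R|.

(* Main.v *)
(* Start with the servers at the two ends and request the middle.  The online
   algorithm pays at least d, and its two servers leave one of the three points,
   say x, uncovered; requesting x from then on costs it at least another d.
   Knowing x in advance, OPT covers both the middle and x at a cost of d.

   Online costs are multiples of d.  So if rho < 2, every sequence that the
   bijection maps into {OPT <= d} has online cost < 2d, hence <= d, and thus
   #{OPT <= d} <= #{A <= d}.  But {A <= d} is a proper subset of {OPT <= d}: the
   adversarial sequence belongs only to the latter. *)
Require Import Defs.
From mathcomp Require Import all_boot all_order all_algebra.
From mathcomp Require Import all_classical all_reals all_analysis.

Set Implicit Arguments.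
Unset Strict Implicit.
Unset Printing Implicit Defensive.

Import Order.TTheory GRing.Theory Num.Theory.
Local Open Scope ring_scope.

Section Sublevel.
Variables (R : realType) (X : finType).
Implicit Types (f g : X -> R) (t : R).

Definition sublevel f t : {set X} := [set x | f x <= t].

Lemma subset_sublevel f g t u :
  (forall x, g x <= t -> f x <= u) -> sublevel g t \subset sublevel f u.
Proof. by move=> gf; apply/fintype.subsetP => x; rewrite !inE; exact: gf. Qed.

Lemma leq_card_sublevel f g (pi : X -> X) t u :
    injective pi -> (forall x, g (pi x) <= t -> f x <= u) ->
  (#|sublevel g t| <= #|sublevel f u|)%N.
Proof.
move=> pi_inj gf; rewrite -(card_preimset _ pi_inj).
suff -> : pi @^-1: sublevel g t = sublevel (g \o pi) t.
  exact/subset_leq_card/subset_sublevel.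
by apply/setP => x; rewrite !inE.
Qed.

End Sublevel.

Section BijectiveRatio.
Variables (R : realType) (T : finType) (costA costB : seq T -> R).
Hypothesis costB_ge0 : forall sigma, 0 <= costB sigma.

Lemma strict_bijective_boundW (rho rho' : R) :
  rho <= rho' -> strict_bijective_bound costA costB rho ->
  strict_bijective_bound costA costB rho'.
Proof.
move=> le_rho [n0 bound]; exists n0 => n /bound [pi [pi_bij pi_le]].
exists pi; split=> // sigma; apply: le_trans (pi_le sigma) _.
exact: ler_wpM2r.
Qed.

Hypothesis costB_le_costA : forall sigma, costB sigma <= costA sigma.
Variables (t u : R).
Hypotheses (t_gt0 : 0 < t) (t_lt_u : t < u).
Hypothesis costA_gap : forall sigma, costA sigma < u -> costA sigma <= t.
Hypothesis separated :
  forall n, exists2 sigma, (n <= size sigma)%N & costB sigma <= t < costA sigma.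

Lemma strict_bijective_bound_gap (rho : R) :
  strict_bijective_bound costA costB rho -> u <= rho * t.
Proof.
move=> bound; rewrite leNgt; apply/negP => rho_lt.
pose rho' := Num.max rho 0.
have rho'_ge0 : 0 <= rho' by rewrite le_max lexx orbT.
have rho'_lt : rho' * t < u.
  by rewrite maxr_pMl ?ltW // mul0r gt_max rho_lt (lt_trans t_gt0).
have [|n0 {}bound] := strict_bijective_boundW (rho' := rho') _ bound.
  by rewrite le_max lexx.
have [sigma /bound [pi [pi_bij pi_le]] /andP[sigmaB sigmaA]] := separated n0.
pose subA := sublevel (fun s : (size sigma).-tuple T => costA s) t.
pose subB := sublevel (fun s : (size sigma).-tuple T => costB s) t.
have card_le : (#|subB| <= #|subA|)%N.
  apply: leq_card_sublevel (bij_inj pi_bij) _ => s pi_s; apply: costA_gap.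
  exact: le_lt_trans (pi_le s) (le_lt_trans (ler_wpM2l rho'_ge0 pi_s) rho'_lt).
have card_lt : (#|subA| < #|subB|)%N.
  apply/proper_card/properP; split.
    by apply: subset_sublevel => s; apply: le_trans.
  by exists (in_tuple sigma); rewrite !inE // -ltNge.
by rewrite ltnNge card_le in card_lt.
Qed.

Lemma strict_bijective_ratio_gap :
  ((u / t)%:E <= strict_bijective_ratio costA costB)%E.
Proof.
apply/ereal_infP => _ [rho bound <-].
by rewrite lee_fin ler_pdivrMr // strict_bijective_bound_gap.
Qed.

End BijectiveRatio.

Section Serving.
Variables (T : finType) (k : nat).
Implicit Types (c : {ffun 'I_k -> T}) (sigma : seq T).

Lemma exists_unserved c : (k < #|T|)%N -> exists x, ~~ serves c x.
Proof.
move=> lt_kT; apply/existsP; rewrite -negb_forall.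
apply/negP => /forallP all_served.
suff : (#|T| <= k)%N by rewrite leqNgt lt_kT.
rewrite -[leqRHS]card_ord; apply: leq_trans (leq_image_card c 'I_k).
apply/subset_leq_card/fintype.subsetP => x _.
by have /existsP[i /eqP <-] := all_served x; exact: codom_f.
Qed.

Lemma feasible_nseq c sigma :
  feasible (nseq (size sigma) c) sigma = all (serves c) sigma.
Proof. by rewrite /feasible; elim: sigma => //= x sigma ->. Qed.

Lemma feasible_rcons (s : seq {ffun 'I_k -> T}) c sigma x :
  feasible s sigma -> serves c x -> feasible (rcons s c) (rcons sigma x).
Proof.
rewrite /feasible !all2E !size_rcons => /andP[/eqP size_s s_sigma] c_x.
by rewrite size_s eqxx zip_rcons // all_rcons /= c_x.
Qed.

Variables (c0 : {ffun 'I_k -> T}) (A : online_alg c0).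

Lemma online_schedule_rcons sigma x :
  online_schedule A (rcons sigma x) =
  rcons (online_schedule A sigma) (A (rcons sigma x)).
Proof.
rewrite /online_schedule -![map _ _]/(mkseq _ _) size_rcons mkseqS.
rewrite [take (size sigma).+1 _]take_oversize ?size_rcons //; congr rcons.
apply/eq_in_map => t; rewrite mem_iota => lt_t.
by rewrite -cats1 takel_cat.
Qed.

Lemma feasible_online_schedule sigma : feasible (online_schedule A sigma) sigma.
Proof.
elim/last_ind: sigma => // sigma x IH; rewrite online_schedule_rcons.
exact/feasible_rcons/alg_serves.
Qed.

Lemma last_online_schedule sigma : last c0 (online_schedule A sigma) = A sigma.
Proof.
case/lastP: sigma => [|sigma x]; first by rewrite /= alg_init.
by rewrite online_schedule_rcons last_rcons.
Qed.

End Serving.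

Section Costs.
Variables (R : realType) (T : finType) (k : nat) (dist : T -> T -> R).
Implicit Types (c : {ffun 'I_k -> T}) (s : seq {ffun 'I_k -> T}).
Implicit Types sigma tau : seq T.

Lemma schedule_cost_rcons c s c' :
  schedule_cost dist c (rcons s c') =
  schedule_cost dist c s + move_cost dist (last c s) c'.
Proof.
by elim: s c => [|c1 s IH] c /=; rewrite ?addr0 ?add0r // IH addrA.
Qed.

Lemma online_cost_rcons c (A : online_alg c) sigma x :
  online_cost dist A (rcons sigma x) =
  online_cost dist A sigma + move_cost dist (A sigma) (A (rcons sigma x)).
Proof.
rewrite /online_cost online_schedule_rcons schedule_cost_rcons.
by rewrite last_online_schedule.
Qed.

Lemma schedule_cost_ind (P : R -> Prop) c s :
    P 0 -> (forall a b, P a -> P b -> P (a + b)) ->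
    (forall x y, P (dist x y)) ->
  P (schedule_cost dist c s).
Proof.
move=> P0 PD Pdist; elim: s c => //= c' s IH c.
by apply: (PD) (IH c'); rewrite /move_cost; apply: big_ind.
Qed.

Lemma schedule_cost_stay c n :
  (forall x, dist x x = 0) -> schedule_cost dist c (nseq n c) = 0.
Proof.
move=> dist_xx; elim: n => //= n ->.
by rewrite addr0 /move_cost big1.
Qed.

Hypothesis dist_ge0 : forall x y, 0 <= dist x y.

Lemma move_cost_ge0 c c' : 0 <= move_cost dist c c'.
Proof. exact: sumr_ge0. Qed.

Lemma schedule_cost_ge0 c s : 0 <= schedule_cost dist c s.
Proof.
by apply: (schedule_cost_ind (P := fun a => 0 <= a)) => // a b; apply: addr_ge0.
Qed.

Lemma move_cost_unserved d c c' x :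
    (forall y z, y != z -> d <= dist y z) ->
  ~~ serves c x -> serves c' x -> d <= move_cost dist c c'.
Proof.
move=> dist_ge c_x /existsP[i /eqP c'i].
rewrite /move_cost (bigD1 i) //= -[leLHS]addr0 lerD ?sumr_ge0 // dist_ge // c'i.
by apply: contraNneq c_x => ci; apply/existsP; exists i; rewrite ci.
Qed.

Lemma opt_cost_ge0 c sigma : 0 <= opt_cost dist c sigma.
Proof.
rewrite /opt_cost; set costs := (X in inf X).
have [->|costs_neq0] := eqVneq costs classical_sets.set0; first by rewrite inf0.
apply: lb_le_inf; first exact/classical_sets.set0P.
by move=> _ [s _ <-]; exact: schedule_cost_ge0.
Qed.

Lemma opt_cost_le c s sigma :
  feasible s sigma -> opt_cost dist c sigma <= schedule_cost dist c s.
Proof.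
move=> s_sigma; apply: ge_inf; last by exists s.
by exists 0 => _ [s' _ <-]; exact: schedule_cost_ge0.
Qed.

Lemma opt_cost_le_online c (A : online_alg c) sigma :
  opt_cost dist c sigma <= online_cost dist A sigma.
Proof. exact/opt_cost_le/feasible_online_schedule. Qed.

Lemma opt_cost_le_move c c' sigma :
    (forall x, dist x x = 0) -> all (serves c') sigma ->
  opt_cost dist c sigma <= move_cost dist c c'.
Proof.
move=> dist_xx; rewrite -feasible_nseq => /(opt_cost_le c) /le_trans; apply.
case: (size sigma) => [|n] /=; first exact: move_cost_ge0.
by rewrite schedule_cost_stay // addr0.
Qed.

Lemma online_cost_cat c (A : online_alg c) sigma tau :
  online_cost dist A sigma <= online_cost dist A (sigma ++ tau).
Proof.
elim/last_ind: tau => [|tau x IH]; first by rewrite cats0.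
by rewrite -rcons_cat online_cost_rcons ler_wpDr ?move_cost_ge0.
Qed.

End Costs.

Section Adversary.
Variables (R : realType) (T : finType) (k : nat) (dist : T -> T -> R) (d : R).
Hypothesis d_gt0 : 0 < d.
Hypothesis dist_natr : forall x y, dist x y / d \is a Num.nat.
Hypothesis dist_eq0 : forall x y, (dist x y == 0) = (x == y).
Implicit Types (c : {ffun 'I_k -> T}) (sigma : seq T).

Let dist_ge0 x y : 0 <= dist x y.
Proof. by rewrite -(pmulr_lge0 _ (x := d^-1)) ?invr_gt0 // natr_ge0. Qed.

Let dist_xx x : dist x x = 0.
Proof. by apply/eqP; rewrite dist_eq0. Qed.

Let dist_ge x y : x != y -> d <= dist x y.
Proof.
rewrite -dist_eq0 => dist_neq0; rewrite -[leLHS]mul1r -ler_pdivlMr //.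
have : 0 < dist x y / d by rewrite divr_gt0 // lt0r dist_neq0 dist_ge0.
by have /natrP[n ->] := dist_natr x y; rewrite ltr0n ler1n.
Qed.

Lemma online_cost_natr c (A : online_alg c) sigma :
  online_cost dist A sigma / d \is a Num.nat.
Proof.
apply: (schedule_cost_ind (P := fun a => a / d \is a Num.nat)) => //.
  by rewrite mul0r rpred0.
by move=> a b a_nat b_nat; rewrite mulrDl rpredD.
Qed.

Lemma online_cost_gap c (A : online_alg c) sigma :
  online_cost dist A sigma < 2 * d -> online_cost dist A sigma <= d.
Proof.
have /natrP[n cost_n] := online_cost_natr A sigma.
by rewrite -ltr_pdivrMr // -[leRHS]mul1r -ler_pdivrMr // cost_n ltr_nat lern1.
Qed.

Variables (c0 : {ffun 'I_k -> T}) (hub : T).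
Hypothesis few_servers : (k < #|T|)%N.
Hypothesis hub_unserved : ~~ serves c0 hub.
Hypothesis unit_cover : forall x,
  exists c, [/\ serves c hub, serves c x & move_cost dist c0 c <= d].

Lemma online_cost_unserved (A : online_alg c0) sigma x :
  ~~ serves (A sigma) x ->
  online_cost dist A sigma + d <= online_cost dist A (rcons sigma x).
Proof.
move=> unserved; rewrite online_cost_rcons lerD2l.
exact: move_cost_unserved unserved (alg_serves _ _ _).
Qed.

Lemma opt_cheap_online_expensive (A : online_alg c0) n :
  exists2 sigma, (n <= size sigma)%N &
    opt_cost dist c0 sigma <= d < online_cost dist A sigma.
Proof.
have [x x_unserved] := exists_unserved (A [:: hub]) few_servers.
exists ([:: hub; x] ++ nseq n x); first by rewrite size_cat size_nseq leq_addl.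
apply/andP; split.
  have [c [c_hub c_x cost_c]] := unit_cover x; apply: le_trans cost_c.
  by apply: opt_cost_le_move => //=; rewrite c_hub c_x all_nseq c_x orbT.
apply: lt_le_trans (online_cost_cat dist_ge0 A _ _).
have hub_cost : d <= online_cost dist A [:: hub].
  have init_unserved : ~~ serves (A [::]) hub by rewrite alg_init.
  by apply: le_trans (online_cost_unserved init_unserved); rewrite add0r.
apply: lt_le_trans (online_cost_unserved x_unserved).
by rewrite (le_lt_trans hub_cost) ?ltrDl.
Qed.

Lemma strict_bijective_ratio_ge2 (A : online_alg c0) :
  (2%:E <= strict_bijective_ratio (online_cost dist A) (opt_cost dist c0))%E.
Proof.
rewrite -[2](mulfK (lt0r_neq0 d_gt0)); apply: strict_bijective_ratio_gap => //.
- exact: opt_cost_ge0.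
- exact: opt_cost_le_online.
- by rewrite mulr_natl mulr2n ltrDl.
- exact: online_cost_gap.
- exact: opt_cheap_online_expensive.
Qed.

End Adversary.

Section TwoServers.
Variable T : finType.
Implicit Types x y z : T.

Definition pair_config x y : {ffun 'I_2 -> T} :=
  [ffun i => if i == ord0 then x else y].

Lemma serves_pair_config x y z :
  serves (pair_config x y) z = (x == z) || (y == z).
Proof.
apply/existsP/orP => [[i]|[x_z|y_z]].
- by rewrite ffunE; case: (i == ord0); [left|right].
- by exists ord0; rewrite ffunE.
- by exists ord_max; rewrite ffunE.
Qed.

Lemma move_cost_pair_config (R : realType) (dist : T -> T -> R) x y x' y' :
  move_cost dist (pair_config x y) (pair_config x' y') = dist x x' + dist y y'.
Proof. by rewrite /move_cost big_ord_recl big_ord1 !ffunE. Qed.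

End TwoServers.

Section Line3.
Variables (R : realType) (d : R).
Hypothesis d_gt0 : 0 < d.

Definition midpoint : 'I_3 := @Ordinal 3 1 isT.

Lemma line3_dist_natr x y : line3_dist d x y / d \is a Num.nat.
Proof.
rewrite /line3_dist mulrAC divff ?lt0r_neq0 // mul1r natr_norm_int //.
by rewrite rpredB ?intr_nat.
Qed.

Lemma line3_dist_eq0 x y : (line3_dist d x y == 0) = (x == y).
Proof.
by rewrite /line3_dist mulf_eq0 gt_eqF //= normr_eq0 subr_eq0 eqr_nat.
Qed.

Lemma line3_unit_cover x : exists c,
  [/\ serves c midpoint, serves c x &
      move_cost (line3_dist d) (pair_config ord0 ord_max) c <= d].
Proof.
have line3_dist_xx y : line3_dist d y y = 0.
  by apply/eqP; rewrite line3_dist_eq0.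
have x_covered : serves (pair_config ord0 midpoint) x
              || serves (pair_config midpoint ord_max) x.
  by rewrite !serves_pair_config; case: x => -[|[|[]]].
case/orP: x_covered => c_x.
- exists (pair_config ord0 midpoint); rewrite serves_pair_config eqxx orbT.
  split=> //; rewrite move_cost_pair_config line3_dist_xx add0r /line3_dist /=.
  by rewrite -natrB // normr1 mulr1.
- exists (pair_config midpoint ord_max); rewrite serves_pair_config eqxx.
  split=> //; rewrite move_cost_pair_config line3_dist_xx addr0 /line3_dist /=.
  by rewrite sub0r normrN normr1 mulr1.
Qed.

End Line3.

Theorem theorem6 (R : realType) (d : R) (hd : 0 < d) :
  exists c0 : {ffun 'I_2 -> 'I_3},
    forall A : online_alg c0,
      (2%:E <= strict_bijective_ratio (online_cost (line3_dist d) A)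
                                      (opt_cost (line3_dist d) c0))%E.
Proof.
exists (pair_config ord0 ord_max) => A.
apply: (strict_bijective_ratio_ge2 hd _ _ _ _ (line3_unit_cover hd)).
- exact: line3_dist_natr.
- exact: line3_dist_eq0.
- by rewrite card_ord.
- by rewrite serves_pair_config.
Qed.
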